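(* Let $n\ge 2$ and let $B_n$ be the group of signed permutations of $[\pm n]=\{-n,\dots,-1,1,\dots,n\}$, i.e. bijections $w$ of $[\pm n]$ with $w(-a)=-w(a)$, written in window notation $[w(1)\,w(2)\cdots w(n)]$, with negatives written $\underline{a}=-a$. Define $f^B_0=[\underline{1}\;2\;3\cdots n]$ and, for $1\le i\le n-1$, $f^B_i=[\underline{i+1}\;\underline{i}\;\cdots\;\underline{1}\;(i+2)\cdots n]$, i.e. $f^B_i(m)=-(i+2-m)$ for $1\le m\le i+1$ and $f^B_i(m)=m$ for $i+1<m\le n$. For $0\le a,b\le n-1$ let $m^B_{a,b}$ denote the order of $f^B_af^B_b$. Let $i,j$ be integers with $1\le i<j\le n$. Then: \begin{enumerate} \item $m^B_{i-1,i-1}=1$; \item $m^B_{i-1,j-1}=m^B_{j-1,i-1}$; \item if $j\ge 4$ and $1<i\le\lfloor j/2\rfloor$, then $m^B_{i-1,j-1}=4$; \item if $j\ge4$ and $1\le\lfloor j/2\rfloor<i<j-1$, then, with $d=j-i$, $q=\lfloor j/d\rfloor$ and $r=j\bmod d$, \[m^B_{i-1,j-1}=\begin{cases}2q, & \text{if } r=0,\\ 2q(q+1), & \text{if } r\neq0;\end{cases}\] \item if $j\ge 3$ and $i=j-1$, then $m^B_{i-1,j-1}=2j$. \end{enumerate}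
   Context: Signed permutations are composed as functions. *)

(* Defs.v *)
From HB Require Import structures.
From mathcomp Require Import all_boot all_order all_algebra all_fingroup zify.

Set Implicit Arguments.
Unset Strict Implicit.
Unset Printing Implicit Defensive.

Import Order.TTheory GRing.Theory Num.Theory.

Local Open Scope ring_scope.

(* [±n], the nonzero integers of absolute value at most n. *)
Definition in_pm (n : nat) (x : int) : bool := (x != 0) && (`|x| <= n)%N.

Record pm (n : nat) : predArgType := PM { pmval :> int; _ : in_pm n pmval }.

HB.instance Definition _ n := [isSub for @pmval n].
HB.instance Definition _ n := [Choice of pm n by <:].
HB.instance Definition _ n := [Countable of pm n by <:].

Definition pm_encode (n : nat) (x : pm n) : bool * 'I_n.+1 :=
  (0 < pmval x, inord `|pmval x|%N).

Definition pm_decode (n : nat) (p : bool * 'I_n.+1) : option (pm n) :=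
  insub (if p.1 then p.2%:Z else - p.2%:Z).

Lemma pm_encodeK n : pcancel (@pm_encode n) (@pm_decode n).
Proof.
move=> [x xP]; rewrite /pm_encode /pm_decode /=.
have := xP; rewrite /in_pm => /andP[x0 xn].
rewrite inordK ?ltnS //.
have -> : (if 0 < x then `|x|%:Z else - `|x|%:Z) = x by case: ifP; lia.
by rewrite (insubT (in_pm n) xP).
Qed.

HB.instance Definition _ n : isFinite (pm n) := PCanIsFinite (@pm_encodeK n).

Lemma pmP n (x : pm n) : in_pm n x.
Proof. exact: valP x. Qed.

Lemma pm_opp_subproof n (x : pm n) : in_pm n (- pmval x).
Proof. by have := pmP x; rewrite /in_pm oppr_eq0 abszN. Qed.

Definition pm_opp (n : nat) (x : pm n) : pm n := PM (pm_opp_subproof x).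

Definition signed_perms (n : nat) : {set {perm pm n}} :=
  [set w : {perm pm n} | [forall x, w (pm_opp x) == pm_opp (w x)]].

Lemma signed_perms_group_set n : group_set (signed_perms n).
Proof.
apply/group_setP; split=> [|v w].
  by rewrite inE; apply/forallP => x; rewrite !perm1.
rewrite !inE => /forallP vP /forallP wP; apply/forallP => x.
by rewrite !permM (eqP (vP x)) (eqP (wP _)).
Qed.

Canonical signed_perms_group (n : nat) : {group {perm pm n}} :=
  Group (signed_perms_group_set n).

Notation B n := [subg signed_perms_group n].

Definition fB_window (i m : nat) : int :=
  if (m <= i.+1)%N then - (i.+2%:Z - m%:Z) else m%:Z.

(* Extension of the window to negative integers by w(-m) = -w(m). The index i
   is only meaningful for i < n; otherwise we take the identity. *)
Definition fB_val (n i : nat) (x : int) : int :=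
  if (i < n)%N then
    if 0 < x then fB_window i `|x|%N else - fB_window i `|x|%N
  else x.

Lemma fB_val_subproof n i (x : pm n) : in_pm n (fB_val n i x).
Proof.
case: x => x /=; rewrite /in_pm /fB_val /fB_window.
by case: ltnP => // lt_in; case: ifP; case: ifP; lia.
Qed.

Definition fB_fun (n i : nat) (x : pm n) : pm n := PM (fB_val_subproof i x).

Lemma fB_funK n i : involutive (@fB_fun n i).
Proof.
case=> x xP; apply: val_inj; move: xP; rewrite /= /in_pm /fB_val /fB_window.
case: ltnP => // lt_in xP.
by case: (ifP (0 < x)) => x0; case: (ifP (`|x| <= i.+1)%N) => xi;
  do 2![case: ifP => ?]; lia.
Qed.

Definition fB_perm (n i : nat) : {perm pm n} := perm (inv_inj (@fB_funK n i)).

Lemma fB_perm_signed n i : fB_perm n i \in signed_perms_group n.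
Proof.
rewrite inE; apply/forallP => x; apply/eqP; rewrite !permE.
apply: val_inj; case: x => x; rewrite /= /in_pm /fB_val /fB_window.
rewrite abszN oppr_gt0; case: ltnP => // lt_in xP.
by case: (ltrgtP x 0) xP => //= x0 _; case: ifP => _; rewrite ?opprK.
Qed.

Definition fB (n i : nat) : B n := Subg (fB_perm_signed n i).

Lemma fBE n i (x : pm n) (m : nat) : (i < n)%N -> (0 < m <= n)%N ->
  pmval x = m%:Z ->
  pmval (sgval (fB n i) x) =
    if (m <= i.+1)%N then - (i.+2%:Z - m%:Z) else m%:Z.
Proof.
move=> lt_in /andP[m0 _] xm; rewrite /= permE /= /fB_val lt_in xm.
by rewrite ltz_nat m0.
Qed.

(* The product v * w of permutations maps x to w (v x), so that the composite
   of functions f^B_a f^B_b is fB n b * fB n a. *)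
Definition mB (n a b : nat) : nat := #[(fB n b * fB n a)%g]%g.

Lemma fB_compE n a b (x : pm n) :
  sgval (fB n b * fB n a)%g x = sgval (fB n a) (sgval (fB n b) x).
Proof. by rewrite /= permM. Qed.

(* Main.v *)
(** Put [d = j - i] and let [G] be the composite of [f_{j-1}] followed by
    [f_{i-1}].  For [x > 0], [G] maps [x] to [x - d] when [d < x <= j] and to
    [- (j + 1 - x)] when [x <= d], and [G] is odd.  A cycle through
    [x] in [[1, d]] thus jumps to [- (j + 1 - x)], climbs by [d] up to
    [- x'], where [x'] in [[1, d]] is congruent to [j + 1 - x] mod [d], jumps
    to [j + 1 - x'] and descends to [x].  Its length is [2 (m + 1)] with
    [x + x' + m d = j + 1].  Writing [j = q d + r], this length is [2 (q + 1)]
    for [x <= r] and [2 q] for [r < x <= d], and the order is the least common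
    multiple of these.  The last three items are all instances of this
    formula. *)
Require Import Defs.
From mathcomp Require Import all_boot all_order all_algebra.
From mathcomp Require Import all_fingroup cyclic zify.

Import Order.TTheory GRing.Theory Num.Theory.

(** * The signed reversals on integers *)

Lemma fB_val_le n i (x : nat) : 0 < i <= n -> 0 < x <= i ->
  fB_val n (i - 1) x = (- (i.+1 - x)%N%:Z)%R.
Proof.
rewrite /fB_val /fB_window => i_n xi.
by rewrite !ifT; lia.
Qed.

Lemma fB_val_gt n i (x : nat) : 0 < i -> i < x -> fB_val n (i - 1) x = x.
Proof.
rewrite /fB_val /fB_window => i_gt0 ix.
case: ifP => // _; rewrite ifT; last by lia.
by rewrite ifF; lia.
Qed.

Lemma fB_valN n i (x : int) : (x != 0 -> fB_val n i (- x) = - fB_val n i x)%R.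
Proof.
rewrite /fB_val abszN oppr_gt0; case: ifP => // _.
by case: (ltrgtP x 0%R) => //=; rewrite opprK.
Qed.

Lemma fB_val_neq0 n i (x : int) : (x != 0 -> fB_val n i x != 0)%R.
Proof.
rewrite /fB_val /fB_window => x0.
by case: ifP => // _; case: ifP => _; case: ifP => ?; lia.
Qed.

(** Acts on bare integers, so that iterates are computed without membership proofs; [fB_prod_expE]
    returns to the group. *)
Definition fB_comp (n i j : nat) (x : int) : int :=
  fB_val n (i - 1) (fB_val n (j - 1) x).

Section Cycles.

Variables n i j d : nat.
Hypotheses (i_gt0 : 0 < i) (d_gt0 : 0 < d) (jE : j = i + d) (le_jn : j <= n).

Local Notation G := (fB_comp n i j).

Lemma fB_comp_jump (x : nat) : 0 < x <= d -> G x = (- (j.+1 - x)%N%:Z)%R.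
Proof.
move=> xd; rewrite /fB_comp fB_val_le; [|lia..].
by rewrite fB_valN ?fB_val_gt; lia.
Qed.

Lemma fB_comp_shift (x : nat) : 0 < x -> x + d <= j -> G (x + d)%N = x.
Proof.
move=> x_gt0 xd; rewrite /fB_comp fB_val_le; [|lia..].
by rewrite fB_valN ?fB_val_le; lia.
Qed.

Lemma fB_comp_out (x : nat) : j < x -> G x = x.
Proof. by move=> xj; rewrite /fB_comp !fB_val_gt; lia. Qed.

Lemma fB_compN (x : int) : (x != 0 -> G (- x) = - G x)%R.
Proof. by move=> x0; rewrite /fB_comp !fB_valN // fB_val_neq0. Qed.

Lemma fB_comp_neq0 (x : int) : (x != 0 -> G x != 0)%R.
Proof. by move=> x0; rewrite /fB_comp !fB_val_neq0. Qed.

Lemma iter_fB_comp_neq0 k (x : int) : (x != 0 -> iter k G x != 0)%R.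
Proof. by move=> x0; elim: k => //= k; apply: fB_comp_neq0. Qed.

Lemma iter_fB_compN k (x : int) : (x != 0 -> iter k G (- x) = - iter k G x)%R.
Proof.
by move=> x0; elim: k => //= k ->; rewrite fB_compN // iter_fB_comp_neq0.
Qed.

Lemma iter_fB_comp_shift (x s k : nat) : 0 < x -> x + (k + s) * d <= j ->
  iter s G (x + (k + s) * d)%N = (x + k * d)%N.
Proof.
move=> x_gt0; elim: s => [|s IHs] le_j; first by rewrite addn0.
have -> : x + (k + s.+1) * d = (x + (k + s) * d) + d by lia.
rewrite iterSr fB_comp_shift; [|lia..].
by apply: IHs; lia.
Qed.

Section HalfCycle.

Variables x y m : nat.
Hypotheses (xd : 0 < x <= d) (yd : 0 < y <= d) (xyE : x + y + m * d = j.+1).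

Lemma iter_fB_comp_half s : s <= m ->
  iter s.+1 G x = (- (y + (m - s) * d)%N%:Z)%R.
Proof.
move=> le_sm; rewrite iterSr fB_comp_jump //.
(* Up to sign, the landing point of the jump: [m] shifts above [y], of which [s] are made. *)
have -> : j.+1 - x = y + ((m - s) + s) * d by rewrite subnK //; lia.
rewrite iter_fB_compN; last by lia.
by rewrite iter_fB_comp_shift //; [lia|rewrite subnK //; lia].
Qed.

Lemma iter_fB_comp_halfE : iter m.+1 G x = (- y%:Z)%R.
Proof. by rewrite iter_fB_comp_half // subnn addn0. Qed.

End HalfCycle.

Section Cycle.

Variables x y m : nat.
Hypotheses (xd : 0 < x <= d) (yd : 0 < y <= d) (xyE : x + y + m * d = j.+1).

(** This is the first half with [x] and [y] exchanged and the signs reversed. *)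
Lemma iter_fB_comp_second_half s : s <= m ->
  iter (s.+1 + m.+1) G x = (x + (m - s) * d)%N.
Proof.
move=> le_sm; rewrite iterD (iter_fB_comp_halfE x y m) //.
rewrite iter_fB_compN; last by lia.
by rewrite (iter_fB_comp_half y x m) ?opprK //; lia.
Qed.

Lemma iter_fB_comp_cycle : iter (2 * m.+1) G x = x.
Proof.
by rewrite mul2n -addnn iter_fB_comp_second_half // subnn addn0.
Qed.

Lemma iter_fB_comp_cycleM k : iter (k * (2 * m.+1)) G x = x.
Proof.
by elim: k => // k IHk; rewrite mulSn iterD IHk iter_fB_comp_cycle.
Qed.

(** Only the remainder of [N] modulo the cycle length matters. If nonzero, it leads to a negative
    value in the first half, or to one above [x] in the second. *)
Lemma cycle_dvdn N : iter N G x = x -> 2 * m.+1 %| N.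
Proof.
rewrite {1}(divn_eq N (2 * m.+1)) addnC iterD iter_fB_comp_cycleM /dvdn.
have : N %% (2 * m.+1) < 2 * m.+1 by rewrite ltn_mod.
case: (N %% _) => // s lt_s; have [le_sm|lt_ms] := leqP s m.
  by rewrite (iter_fB_comp_half x y m) //; move: ((m - s) * d) => z; lia.
have -> : s.+1 = (s - m.+1).+1 + m.+1 by lia.
rewrite iter_fB_comp_second_half; last by lia.
have : 0 < (m - (s - m.+1)) * d by rewrite muln_gt0 d_gt0 andbT; lia.
lia.
Qed.

End Cycle.

(** * Cycle lengths and their least common multiple *)

Local Notation q := (j %/ d).
Local Notation r := (j %% d).
Local Notation period := (if r == 0 then 2 * q else 2 * q * (q + 1)).

Let jqr : j = q * d + r := divn_eq j d.
Let lt_rd : r < d. Proof. by rewrite ltn_mod. Qed.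
Let q_gt0 : 0 < q. Proof. by rewrite divn_gt0 //; lia. Qed.

(** Supplies the partner of [x] on a short cycle; for [x <= r] it is [r + 1 - x], with [q]
    shifts. *)
Lemma short_cycle_eq (x : nat) : r < x <= d ->
  x + (d + r.+1 - x) + q.-1 * d = j.+1.
Proof. by move=> xd; have := mulSn q.-1 d; rewrite prednK //; lia. Qed.

Lemma iter_period_base (x : nat) : 0 < x <= d -> iter period G x = x.
Proof.
move=> xd; have [le_xr|lt_rx] := leqP x r.
  have -> : period = q * (2 * q.+1) by case: eqP; lia.
  by apply: (iter_fB_comp_cycleM x (r.+1 - x)); lia.
pose k := if r == 0 then 1 else q + 1.
have -> : period = k * (2 * q.-1.+1).
  by rewrite prednK // /k; case: eqP; lia.
by apply: (iter_fB_comp_cycleM x (d + r.+1 - x)) => //;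
  [lia|apply: short_cycle_eq; lia].
Qed.

Lemma dvdn_period N : (forall x : nat, 0 < x <= d -> iter N G x = x) ->
  period %| N.
Proof.
move=> fixN.
have dvd_short : 2 * q %| N.
  rewrite -[q in 2 * q]prednK //.
  (* As [r < d], the point [d] always lies on a short cycle. *)
  apply: (@cycle_dvdn d (d + r.+1 - d)); [lia..| |by apply: fixN; lia].
  by apply: short_cycle_eq; lia.
case: eqP => // r_neq0.
have dvd_long : 2 * q.+1 %| N.
  (* As [r] is nonzero, the point 1 lies on a long cycle. *)
  by apply: (@cycle_dvdn 1 (r.+1 - 1)); [lia..|apply: fixN; lia].
have /dvdnP[N' N_eq] : 2 %| N by apply: dvdn_trans dvd_short; apply: dvdn_mulr.
(* Once 2 is cancelled, the divisors [q] and [q + 1] are coprime. *)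
move: dvd_short dvd_long; rewrite N_eq -mulnA [N' * 2]mulnC !dvdn_pmul2l //.
by rewrite addn1 Gauss_dvd ?coprimenS // => -> ->.
Qed.

Lemma fB_comp_orbit (x : nat) : 0 < x <= j ->
  exists (k y : nat), 0 < y <= d /\ iter k G x = y.
Proof.
(* Dividing [x - 1] puts the residue in [1..d]. *)
move=> xj; exists (x.-1 %/ d), (x.-1 %% d).+1.
have lt_xd : x.-1 %% d < d by rewrite ltn_mod.
split=> //; have := divn_eq x.-1 d => xE.
have := iter_fB_comp_shift (x.-1 %% d).+1 (x.-1 %/ d) 0.
rewrite (_ : _ + (0 + _) * d = x); last by lia.
by rewrite addn0; apply; lia.
Qed.

(** * Transfer to the group of signed permutations *)

Local Notation u := (fB n (j - 1) * fB n (i - 1))%g.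

Lemma fB_prod_expE N (x : pm n) :
  pmval (sgval (u ^+ N)%g x) = iter N G (pmval x).
Proof.
elim: N x => [|N IHN] x; first by rewrite expg0 /= perm1.
by rewrite expgSr [sgval _]/= permM fB_compE /= -IHN !permE.
Qed.

Lemma fB_prod_exp_eq1P N :
  reflect (forall x : pm n, iter N G (pmval x) = pmval x) (u ^+ N == 1)%g.
Proof.
apply: (iffP eqP) => [uN x|fixN]; first by rewrite -fB_prod_expE uN /= perm1.
apply: val_inj; apply/permP => x; apply: val_inj.
by rewrite [LHS]fB_prod_expE fixN /= perm1.
Qed.

Lemma iter_fB_comp_inj k (x y : pm n) :
  iter k G (pmval x) = iter k G (pmval y) -> x = y.
Proof.
by rewrite -!fB_prod_expE => /val_inj /perm_inj.
Qed.

Lemma iter_period_pos (x : nat) : 0 < x <= n -> iter period G x = x.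
Proof.
move=> xn; have [lt_jx|le_xj] := ltnP j x.
  by rewrite iter_fix // fB_comp_out.
have [|k [y [yd ky]]] := fB_comp_orbit x; first by lia.
have xP : in_pm n x by rewrite /in_pm; lia.
rewrite -[Posz x]/(pmval (PM xP)) -fB_prod_expE; congr pmval.
(* Iterates commute, so the claim is moved along [k] steps to the base point [y]. *)
apply: (@iter_fB_comp_inj k); rewrite fB_prod_expE /=.
by rewrite -iterD addnC iterD ky iter_period_base.
Qed.

Lemma order_fB_prod : #[u]%g = period.
Proof.
apply/eqP; rewrite eqn_dvd order_dvdn; apply/andP; split.
  apply/fB_prod_exp_eq1P => -[[x|x] xP] /=; move: xP; rewrite /in_pm => xP.
    by apply: iter_period_pos; lia.
  rewrite NegzE iter_fB_compN; last by lia.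
  by rewrite iter_period_pos //; lia.
apply: dvdn_period => x xd; have xP : in_pm n x by rewrite /in_pm; lia.
by have /fB_prod_exp_eq1P/(_ (PM xP)) := introT eqP (expg_order u).
Qed.

End Cycles.

(** * The five items *)

Lemma fB_mulgg n i : (fB n i * fB n i = 1)%g.
Proof.
apply: val_inj; apply/permP => x.
by rewrite [LHS]fB_compE /= !permE fB_funK.
Qed.

Lemma mB_refl n i : mB n i i = 1.
Proof. by rewrite /mB fB_mulgg order1. Qed.

(** Swapping two involutions inverts their product, which keeps the order. *)
Lemma mB_sym n a b : mB n a b = mB n b a.
Proof.
have fV c : ((fB n c)^-1 = fB n c)%g by apply/eqP; rewrite eq_invg_mul fB_mulgg.
by rewrite /mB -orderV invMg !fV.
Qed.

Lemma mBE n i j : 0 < i < j -> j <= n ->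
  let d := j - i in
  mB n (i - 1) (j - 1) =
    if j %% d == 0 then 2 * (j %/ d) else 2 * (j %/ d) * (j %/ d + 1).
Proof. by move=> ij le_jn /=; apply: order_fB_prod; lia. Qed.

Theorem theorem4p1 (n : nat) (hn : 2 <= n) (i j : nat)
    (hi : 1 <= i) (hij : i < j) (hjn : j <= n) :
  [/\ mB n (i - 1) (i - 1) = 1,
      mB n (i - 1) (j - 1) = mB n (j - 1) (i - 1),
      4 <= j -> 1 < i -> i <= j %/ 2 -> mB n (i - 1) (j - 1) = 4,
      4 <= j -> 1 <= j %/ 2 -> j %/ 2 < i -> i < j - 1 ->
        let d := j - i in
        let q := j %/ d in
        let r := j %% d in
        mB n (i - 1) (j - 1) = if r == 0 then 2 * q else 2 * q * (q + 1)
    & 3 <= j -> i = j - 1 -> mB n (i - 1) (j - 1) = 2 * j].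
Proof.
have ij : 0 < i < j by rewrite hi.
split=> [||_ _ le_i_half|_ _ _ _|_ i_eq].
- exact: mB_refl.
- exact: mB_sym.
(* If [j = 2 * i], then [q = 2] and [r = 0]; otherwise [i < d], so [q = 1] and [r = i]. Both give
   4. *)
- rewrite mBE //; have [j_eq|j_neq] := eqVneq j (2 * i).
    have -> : j - i = i by lia.
    by rewrite j_eq modnMl mulnK.
  have -> : j %/ (j - i) = 1.
    by have := divn_eq j (j - i); have := ltn_mod j (j - i); nia.
  have : j %% (j - i) = i.
    by rewrite -[j in j %% _](@subnK i j) ?modnDl ?modn_small; lia.
  by move=> ->; rewrite -[i == 0]negbK -lt0n hi.
- exact: mBE.
- by rewrite mBE // (_ : j - i = 1) ?modn1 ?divn1 //; lia.
Qed.
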